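(* In the parameterized synthesis setting described in the context, let $\epsilon_f,\epsilon_F\in\mathbb{R}_{>0}$ be given and let the coefficient vectors $\bar\vartheta$ and $\bar\mu$ correspond to an $(\epsilon_f,\epsilon_F)$-optimal solution $\bar\eta=[\bar\xi_h\ \bar\xi_{\underline{\pi}}\ \bar\xi_{\overline{\pi}}\ \bar\xi_s\ \bar\vartheta\ \bar\mu]^\top$ of the bilevel problem (BP). Then the function $h(\cdot;\bar\vartheta)$, with the given $\gamma\in\mathcal{K}_\infty^{\leqslant\mathrm{id}}$, and the control policy $\pi(\cdot;\bar\mu)$ satisfy: 1) $h(f(x,\pi(x;\bar\mu));\bar\vartheta)-h(x;\bar\vartheta)\geqslant-\gamma(h(x;\bar\vartheta))$ for all $x\in\mathcal{C}(\bar\vartheta)$; 2) $\pi(x;\bar\mu)\in\mathbb{U}$ for all $x\in\mathcal{C}(\bar\vartheta)$, and thus $\pi(\cdot;\bar\mu)$ is a friend of $(h(\cdot;\bar\vartheta),\gamma)$; 3) $\mathcal{C}(\bar\vartheta)\subseteq\mathcal{S}$; and thus $(h(\cdot;\bar\vartheta),\gamma)$ with its friend $\pi(\cdot;\bar\mu)$ is a DTCBF and the system $x_{t+1}=f(x_t,u_t)$ with $\mathbb{U}$ is $(\mathcal{S},X_0)$-safe for some $X_0\subseteq\mathcal{C}(\bar\vartheta)$. Moreover, $\mathcal{C}(\bar\vartheta)$ is non-empty, and its size is maximized (within the class of the parameterized DTCBF and the parameterized control policy) up to an $\epsilon_F$ tolerance, i.e. $\rho(\bar\vartheta)+\epsilon_F\geqslant-\rho^*$,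 where $\rho^*$ is the global minimum of (BP).
   Context: Setting. $f:\mathbb{R}^n\times\mathbb{R}^m\to\mathbb{R}^n$; control admissible set $\mathbb{U}=[u^{lb},u^{ub}]=\{u\in\mathbb{R}^m\mid u_i^{lb}\leqslant u_i\leqslant u_i^{ub}\ \forall i\}$; safe set $\mathcal{S}=\{x\in\mathbb{R}^n\mid s(x)\geqslant0\}$ with $s:\mathbb{R}^n\to\mathbb{R}$. $\gamma\in\mathcal{K}_\infty^{\leqslant\mathrm{id}}$ is given: $\gamma:\mathbb{R}_{\geqslant0}\to\mathbb{R}_{\geqslant0}$ continuous, strictly increasing, $\gamma(0)=0$, $\gamma(r)\to\infty$, $\gamma(r)\leqslant r$. Parameterizations: $h(x;\vartheta)=\sum_{i=1}^{n_\vartheta}\Lambda_i(x;\vartheta_i)$ with $\vartheta\in\Theta\subset\mathbb{R}^{n_\vartheta}$ and $\Lambda_i:\mathbb{R}^n\times\mathbb{R}\to\mathbb{R}$ given; $\pi(x;\mu)=[\pi_1(x;\mu_1)\ \cdots\ \pi_m(x;\mu_m)]^\top$, $\pi_i(x;\mu_i)=\sum_{j=1}^{n_{\mu_i}}\Pi_{i,j}(x;\mu_{i,j})$ with $\mu=[\mu_1\cdots\mu_m]^\top\in M\subset\mathbb{R}^{n_\mu}$, $n_\mu=\sum_{i=1}^m n_{\mu_i}$, and $\Pi_{i,j}:\mathbb{R}^n\times\mathbb{R}\to\mathbb{R}$ given. $\mathcal{C}(\vartheta)=\{x\in\mathbb{R}^n\mid h(x;\vartheta)\geqslant0\}$. Standing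 assumptions: $\mathcal{C}(\vartheta)$ is compact for all $\vartheta\in\Theta$; $\Theta$ and $M$ are compact; $f,s,\gamma,\Lambda_i,\Pi_{i,j}$ are twice continuously differentiable; $\mathbb{X}\subset\mathbb{R}^n$ is an $n$-rectangle (a box $\{x\mid x_i^{lb}\leqslant x_i\leqslant x_i^{ub}\}$) with $\mathcal{C}(\vartheta)\subset\mathbb{X}$ and $\partial\mathcal{C}(\vartheta)\cap\partial\mathbb{X}=\emptyset$ for all $\vartheta\in\Theta$; $\nabla_xh(x;\vartheta)\neq0$ for all $\vartheta\in\Theta$ and all $x\in\mathbb{X}$ with $h(x;\vartheta)=0$. Definitions. $(h,\gamma)$ with zero-superlevel set $\mathcal{C}$ is a DTCBF if for every $x\in\mathcal{C}$ there is $u\in\mathbb{U}$ with $h(f(x,u))-h(x)\geqslant-\gamma(h(x))$; $\pi$ is a friend of $(h,\gamma)$ if for all $x\in\mathcal{C}$, $\pi(x)\in\mathbb{U}$ and $u=\pi(x)$ satisfies this inequality. The system is $(\mathcal{S},X_0)$-safe (with $X_0\subseteq\mathcal{S}$) if there is $\kappa:\mathcal{S}\to\mathbb{U}$ such that all trajectories of $x_{t+1}=f(x_t,\kappa(x_t))$ with $x_0\in X_0$ satisfy $x_t\in\mathcal{S}$ for all $t\in\{0,1,2,\dots\}$. Let $\mathcal{H}(\xi;\vartheta,\mu)=h(f(\xi,\pi(\xi;\mu));\vartheta)-h(\xi;\vartheta)+\gamma(h(\xi;\vartheta))$, let $\rho:\mathbb{R}^{n_\vartheta}\to\mathbb{R}$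 be the mapping giving the size $\rho(\vartheta)$ of $\mathcal{C}(\vartheta)$, $\xi_{\underline{\pi}}=[\xi_{\underline{\pi}_1}\cdots\xi_{\underline{\pi}_m}]^\top$, $\xi_{\overline{\pi}}=[\xi_{\overline{\pi}_1}\cdots\xi_{\overline{\pi}_m}]^\top$, with all $\xi_h,\xi_{\underline{\pi}_i},\xi_{\overline{\pi}_i},\xi_s\in\mathbb{R}^n$, and $$\mathcal{F}(\eta)=\mathcal{H}(\xi_h;\vartheta,\mu)+\sum_{i=1}^m[\pi_i(\xi_{\underline{\pi}_i};\mu_i)-\pi_i(\xi_{\overline{\pi}_i};\mu_i)]+s(\xi_s),\qquad\eta=[\xi_h\ \xi_{\underline{\pi}}\ \xi_{\overline{\pi}}\ \xi_s\ \vartheta\ \mu]^\top.$$ Bilevel problem (BP): $\rho^*=\min_{(\vartheta,\mu)\in\Theta\times M}-\rho(\vartheta)$ subject to the outer constraints, for all $i\in\{1,\dots,m\}$, $$-\mathcal{H}(\xi_h^*;\vartheta,\mu)\leqslant-\epsilon_f,\quad -\pi_i(\xi^*_{\underline{\pi}_i};\mu_i)\leqslant-u_i^{lb}-\epsilon_f,\quad \pi_i(\xi^*_{\overline{\pi}_i};\mu_i)\leqslant u_i^{ub}-\epsilon_f,\quad -s(\xi_s^* )\leqslant-\epsilon_f,$$ where $(\xi_h^*,\xi_{\underline{\pi}}^*,\xi_{\overline{\pi}}^*,\xi_s^* )$ is a global minimizer of the inner problem: minimize $\mathcal{F}(\eta)$ over $\xi_h,\xi_{\underline{\pi}_i},\xi_{\overline{\pi}_i},\xi_s\in\mathbb{X}$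 subject to the inner constraints $-h(\xi_h;\vartheta)\leqslant0$, $-h(\xi_{\underline{\pi}_i};\vartheta)\leqslant0$, $-h(\xi_{\overline{\pi}_i};\vartheta)\leqslant0$, $-h(\xi_s;\vartheta)\leqslant0$ for all $i$. $(\epsilon_f,\epsilon_F)$-optimality: $\bar\eta=[\bar\xi_h\ \bar\xi_{\underline{\pi}}\ \bar\xi_{\overline{\pi}}\ \bar\xi_s\ \bar\vartheta\ \bar\mu]^\top$ is an $(\epsilon_f,\epsilon_F)$-optimal solution of (BP) if it satisfies the inner and outer constraints (with $\bar\xi$'s, $\bar\vartheta,\bar\mu$ in place of $\xi^*$'s, $\vartheta,\mu$; including $\bar\vartheta\in\Theta$, $\bar\mu\in M$ and all $\bar\xi$'s in $\mathbb{X}$) and, for all $i$, $$\mathcal{H}(\bar\xi_h;\bar\vartheta,\bar\mu)\leqslant\mathcal{H}(\xi_h^*;\bar\vartheta,\bar\mu)+\epsilon_f,\quad \pi_i(\bar\xi_{\underline{\pi}_i};\bar\mu_i)\leqslant\pi_i(\xi^*_{\underline{\pi}_i};\bar\mu_i)+\epsilon_f,\quad -\pi_i(\bar\xi_{\overline{\pi}_i};\bar\mu_i)\leqslant-\pi_i(\xi^*_{\overline{\pi}_i};\bar\mu_i)+\epsilon_f,$$ $$s(\bar\xi_s)\leqslant s(\xi_s^* )+\epsilon_f,\qquad -\rho^*\leqslant\rho(\bar\vartheta)+\epsilon_F,$$ where $[\xi_h^*\ \xi_{\underline{\pi}}^*\ \xi_{\overline{\pi}}^*\ \xi_s^*]^\top$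 is a global minimizer of the inner problem of (BP) for fixed outer variables $\bar\vartheta,\bar\mu$, and $\rho^*$ is the global minimum of (BP). *)

(* Defs.v *)
From HB Require Import structures.
From mathcomp Require Import all_boot all_order all_algebra.
From mathcomp Require Import all_classical all_reals all_analysis.
Set Implicit Arguments.
Unset Strict Implicit.
Unset Printing Implicit Defensive.
Import Order.TTheory GRing.Theory Num.Theory.
Import numFieldNormedType.Exports.
Local Open Scope classical_set_scope.
Local Open Scope ring_scope.

(* Only meant for finite-dimensional V and W, where continuity of the second
   directional derivatives in all directions is continuity of all second-order
   partial derivatives. *)
Definition C2 (R : realType) (V W : normedModType R) (g : V -> W) : Prop :=
  [/\ forall x, differentiable g x,
      forall v x, differentiable ('D_v g) x
    & forall v w, continuous ('D_w ('D_v g))].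

(* Twice continuous differentiability on the closed half-line: g is the
   restriction of a C^2 function on R.  The values of g on the negative reals
   are irrelevant. *)
Definition C2_halfline (R : realType) (g : R -> R) : Prop :=
  exists2 G : R^o -> R^o, C2 G & forall r : R, 0 <= r -> G r = g r.

Definition gradient (R : realType) (n : nat) (g : 'rV[R]_n -> R)
    (x : 'rV[R]_n) : 'rV[R]_n :=
  \row_i 'D_(delta_mx 0 i) g x.

Definition box (R : realType) (n : nat) (lb ub : 'rV[R]_n) : set 'rV[R]_n :=
  [set x | forall i, lb 0 i <= x 0 i <= ub 0 i].

Definition boundary (T : topologicalType) (A : set T) : set T :=
  closure A `\` interior A.

(* A function R_{>=0} -> R_{>=0} is represented by a function on R whose values
   at negative reals play no role. *)
Definition Kinf_le_id (R : realType) (gamma : R -> R) : Prop :=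
  [/\ forall r, 0 <= r -> 0 <= gamma r,
      {within [set r : R | 0 <= r], continuous gamma},
      (forall r t, 0 <= r -> r < t -> gamma r < gamma t),
      gamma 0 = 0
    & gamma r @[r --> +oo] --> +oo
      /\ forall r, 0 <= r -> gamma r <= r].

Definition superlevel (R : realType) (n : nat) (g : 'rV[R]_n -> R) :
    set 'rV[R]_n :=
  [set x | 0 <= g x].

Definition is_DTCBF (R : realType) (n m : nat)
    (f : 'rV[R]_n * 'rV[R]_m -> 'rV[R]_n) (U : set 'rV[R]_m)
    (gamma : R -> R) (h : 'rV[R]_n -> R) : Prop :=
  forall x, superlevel h x ->
    exists2 u, U u & h (f (x, u)) - h x >= - gamma (h x).

Definition is_friend (R : realType) (n m : nat)
    (f : 'rV[R]_n * 'rV[R]_m -> 'rV[R]_n) (U : set 'rV[R]_m)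
    (gamma : R -> R) (h : 'rV[R]_n -> R) (pi : 'rV[R]_n -> 'rV[R]_m) : Prop :=
  forall x, superlevel h x ->
    U (pi x) /\ h (f (x, pi x)) - h x >= - gamma (h x).

(* A policy S -> U is represented by a total function mapping S into U; its
   values outside S cannot influence whether a trajectory starting in S stays
   in S, since they are only used after the trajectory has left S. *)
Definition is_safe (R : realType) (n m : nat)
    (f : 'rV[R]_n * 'rV[R]_m -> 'rV[R]_n) (U : set 'rV[R]_m)
    (S X0 : set 'rV[R]_n) : Prop :=
  X0 `<=` S /\
  exists2 kappa : 'rV[R]_n -> 'rV[R]_m, (forall x, S x -> U (kappa x)) &
    forall x : nat -> 'rV[R]_n,
      X0 (x 0%N) -> (forall t, x t.+1 = f (x t, kappa (x t))) ->
      forall t, S (x t).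

(* The parameter vector mu of the policy is the concatenation of blocks
   mu_i in R^(nmu i), recovered by submxrow. *)
Record synthesis_data (R : realType) (n m nth : nat) (nmu : 'I_m -> nat) :=
  SynthesisData {
    sd_f : 'rV[R]_n * 'rV[R]_m -> 'rV[R]_n;
    sd_ulb : 'rV[R]_m;
    sd_uub : 'rV[R]_m;
    sd_s : 'rV[R]_n -> R;
    sd_gamma : R -> R;
    sd_Lambda : 'I_nth -> 'rV[R]_n * R -> R;
    sd_Pi : forall i : 'I_m, 'I_(nmu i) -> 'rV[R]_n * R -> R;
    sd_Theta : set 'rV[R]_nth;
    sd_M : set 'rV[R]_(\sum_i nmu i);
    sd_xlb : 'rV[R]_n;
    sd_xub : 'rV[R]_n;
    (* the size of the zero-superlevel set C(theta), as a function of theta;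
       no particular notion of size is prescribed *)
    sd_rho : 'rV[R]_nth -> R
  }.

Definition sd_U (R : realType) (n m nth : nat) (nmu : 'I_m -> nat)
    (P : synthesis_data R n nth nmu) : set 'rV[R]_m :=
  box (sd_ulb P) (sd_uub P).

Definition sd_S (R : realType) (n m nth : nat) (nmu : 'I_m -> nat)
    (P : synthesis_data R n nth nmu) : set 'rV[R]_n :=
  superlevel (sd_s P).

Definition sd_X (R : realType) (n m nth : nat) (nmu : 'I_m -> nat)
    (P : synthesis_data R n nth nmu) : set 'rV[R]_n :=
  box (sd_xlb P) (sd_xub P).

Definition sd_h (R : realType) (n m nth : nat) (nmu : 'I_m -> nat)
    (P : synthesis_data R n nth nmu) (th : 'rV[R]_nth) (x : 'rV[R]_n) : R :=
  \sum_(i < nth) sd_Lambda P i (x, th 0 i).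

Definition sd_C (R : realType) (n m nth : nat) (nmu : 'I_m -> nat)
    (P : synthesis_data R n nth nmu) (th : 'rV[R]_nth) : set 'rV[R]_n :=
  superlevel (sd_h P th).

Definition sd_pi_comp (R : realType) (n m nth : nat) (nmu : 'I_m -> nat)
    (P : synthesis_data R n nth nmu) (i : 'I_m) (mui : 'rV[R]_(nmu i))
    (x : 'rV[R]_n) : R :=
  \sum_(j < nmu i) sd_Pi P j (x, mui 0 j).

Definition sd_pi (R : realType) (n m nth : nat) (nmu : 'I_m -> nat)
    (P : synthesis_data R n nth nmu) (mu : 'rV[R]_(\sum_i nmu i))
    (x : 'rV[R]_n) : 'rV[R]_m :=
  \row_i sd_pi_comp P (submxrow mu i) x.

Definition standing_assumptions (R : realType) (n m nth : nat)
    (nmu : 'I_m -> nat) (P : synthesis_data R n nth nmu) : Prop :=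
  [/\ Kinf_le_id (sd_gamma P),
      (forall th, sd_Theta P th -> compact (sd_C P th)),
      compact (sd_Theta P) /\ compact (sd_M P),
      [/\ C2 (sd_f P), C2 (sd_s P : _ -> R^o), C2_halfline (sd_gamma P),
          (forall i, C2 (sd_Lambda P i : 'rV[R]_n * R^o -> R^o))
        & (forall i j, C2 (@sd_Pi _ _ _ _ _ P i j : 'rV[R]_n * R^o -> R^o))]
    & [/\ (forall th, sd_Theta P th -> sd_C P th `<=` sd_X P),
          (forall th, sd_Theta P th ->
             boundary (sd_C P th) `&` boundary (sd_X P) = set0)
        & (forall th x, sd_Theta P th -> sd_X P x -> sd_h P th x = 0 ->
             gradient (sd_h P th) x != 0)]].

(* Inner decision variables: xi_h, the xi_{underline pi_i}, the
   xi_{overline pi_i}, and xi_s. *)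
Record inner_vars (R : realType) (n m : nat) := InnerVars {
  iv_h : 'rV[R]_n;
  iv_lo : 'I_m -> 'rV[R]_n;
  iv_up : 'I_m -> 'rV[R]_n;
  iv_s : 'rV[R]_n
}.

Definition calH (R : realType) (n m nth : nat) (nmu : 'I_m -> nat)
    (P : synthesis_data R n nth nmu) (th : 'rV[R]_nth)
    (mu : 'rV[R]_(\sum_i nmu i)) (x : 'rV[R]_n) : R :=
  sd_h P th (sd_f P (x, sd_pi P mu x)) - sd_h P th x
    + sd_gamma P (sd_h P th x).

Definition calF (R : realType) (n m nth : nat) (nmu : 'I_m -> nat)
    (P : synthesis_data R n nth nmu) (th : 'rV[R]_nth)
    (mu : 'rV[R]_(\sum_i nmu i)) (xi : inner_vars R n m) : R :=
  calH P th mu (iv_h xi)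
    + \sum_i (sd_pi_comp P (submxrow mu i) (iv_lo xi i)
              - sd_pi_comp P (submxrow mu i) (iv_up xi i))
    + sd_s P (iv_s xi).

Definition inner_feasible (R : realType) (n m nth : nat) (nmu : 'I_m -> nat)
    (P : synthesis_data R n nth nmu) (th : 'rV[R]_nth)
    (xi : inner_vars R n m) : Prop :=
  let ok x := sd_X P x /\ - sd_h P th x <= 0 in
  [/\ ok (iv_h xi), (forall i, ok (iv_lo xi i)), (forall i, ok (iv_up xi i))
    & ok (iv_s xi)].

Definition inner_minimizer (R : realType) (n m nth : nat) (nmu : 'I_m -> nat)
    (P : synthesis_data R n nth nmu) (th : 'rV[R]_nth)
    (mu : 'rV[R]_(\sum_i nmu i)) (xi : inner_vars R n m) : Prop :=
  inner_feasible P th xi /\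
  forall xi', inner_feasible P th xi' -> calF P th mu xi <= calF P th mu xi'.

Definition outer_constraints (R : realType) (n m nth : nat)
    (nmu : 'I_m -> nat) (P : synthesis_data R n nth nmu) (epsf : R)
    (th : 'rV[R]_nth) (mu : 'rV[R]_(\sum_i nmu i)) (xi : inner_vars R n m) :
    Prop :=
  [/\ - calH P th mu (iv_h xi) <= - epsf,
      (forall i, - sd_pi_comp P (submxrow mu i) (iv_lo xi i)
                 <= - sd_ulb P 0 i - epsf),
      (forall i, sd_pi_comp P (submxrow mu i) (iv_up xi i)
                 <= sd_uub P 0 i - epsf)
    & - sd_s P (iv_s xi) <= - epsf].

Definition BP_feasible (R : realType) (n m nth : nat) (nmu : 'I_m -> nat)
    (P : synthesis_data R n nth nmu) (epsf : R) (th : 'rV[R]_nth)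
    (mu : 'rV[R]_(\sum_i nmu i)) : Prop :=
  [/\ sd_Theta P th, sd_M P mu
    & exists2 xi, inner_minimizer P th mu xi
                & outer_constraints P epsf th mu xi].

Definition BP_minimum (R : realType) (n m nth : nat) (nmu : 'I_m -> nat)
    (P : synthesis_data R n nth nmu) (epsf rho_star : R) : Prop :=
  (exists th mu, BP_feasible P epsf th mu /\ - sd_rho P th = rho_star) /\
  (forall th mu, BP_feasible P epsf th mu -> rho_star <= - sd_rho P th).

(* rho_star is meant to be the global minimum of the bilevel problem. *)
Definition eps_optimal (R : realType) (n m nth : nat) (nmu : 'I_m -> nat)
    (P : synthesis_data R n nth nmu) (epsf epsF rho_star : R)
    (xi : inner_vars R n m) (th : 'rV[R]_nth)
    (mu : 'rV[R]_(\sum_i nmu i)) : Prop :=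
  [/\ sd_Theta P th /\ sd_M P mu,
      inner_feasible P th xi,
      outer_constraints P epsf th mu xi,
      (exists2 xis, inner_minimizer P th mu xis &
        [/\ calH P th mu (iv_h xi) <= calH P th mu (iv_h xis) + epsf,
            (forall i, sd_pi_comp P (submxrow mu i) (iv_lo xi i)
               <= sd_pi_comp P (submxrow mu i) (iv_lo xis i) + epsf),
            (forall i, - sd_pi_comp P (submxrow mu i) (iv_up xi i)
               <= - sd_pi_comp P (submxrow mu i) (iv_up xis i) + epsf)
          & sd_s P (iv_s xi) <= sd_s P (iv_s xis) + epsf])
    & - rho_star <= sd_rho P th + epsF].

(* Main.v *)
Require Import Defs.
From HB Require Import structures.
From mathcomp Require Import all_boot all_order all_algebra.
From mathcomp Require Import all_classical all_reals all_analysis.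
From mathcomp Require Import lra.
Import Order.TTheory GRing.Theory Num.Theory.
Import numFieldNormedType.Exports.
Local Open Scope classical_set_scope.
Local Open Scope ring_scope.

(** The inner cost is a sum of terms in pairwise different variables, each
    ranging independently over [C(theta)] (which lies in [X]).  Changing one
    variable at a time therefore shows that a global inner minimizer minimizes
    [H], [pi_i], [- pi_i] and [s] separately over [C(theta)]
    ([inner_minimizer_separate]).

    An approximate solution exceeds each of these minima by at most [epsf],
    while the outer constraints hold at it with margin [epsf].  The tolerance
    and the margin cancel, so the constraints hold without margin at the exact
    minimizers, hence on all of [C(theta)] ([eps_optimal_constraints]): this
    gives the decrease condition, the input bounds and the inclusion of
    [C(theta)] in the safe set.

    Safety follows by invariance: since [gamma r <= r], the decrease condition
    gives [h (f (x, pi x)) >= h x - gamma (h x) >= 0] on [C(theta)], so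
    trajectories under [pi] never leave [C(theta)], and [X0 = C(theta)] is
    admissible.  This set contains the inner variables of the given solution,
    hence is nonempty. *)

Lemma sum_update_le (R : realType) (I : finType) (T : Type)
    (F : I -> T -> R) (x : I -> T) (k : I) (z : T) :
  \sum_i F i (x i) <= \sum_i F i (if i == k then z else x i) ->
  F k (x k) <= F k z.
Proof.
rewrite (bigD1 k) //= [leRHS](bigD1 k) //= eqxx.
rewrite [X in _ <= _ + X](eq_bigr (fun i => F i (x i))) ?lerD2r //.
by move=> i /negbTE->.
Qed.

(** The inner feasible set is a product, so one variable may be moved to [x]
    while the others stay put; [C(theta)] being contained in [X] makes every
    point of [C(theta)] an admissible value of that variable. *)
Lemma inner_minimizer_separate (R : realType) (n m nth : nat)
    (nmu : 'I_m -> nat) (P : synthesis_data R n nth nmu) (th : 'rV[R]_nth)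
    (mu : 'rV[R]_(\sum_i nmu i)) (xi : inner_vars R n m) (x : 'rV[R]_n) :
  sd_C P th `<=` sd_X P -> inner_minimizer P th mu xi -> sd_C P th x ->
  [/\ calH P th mu (iv_h xi) <= calH P th mu x,
      (forall i, sd_pi_comp P (submxrow mu i) (iv_lo xi i)
                 <= sd_pi_comp P (submxrow mu i) x),
      (forall i, sd_pi_comp P (submxrow mu i) x
                 <= sd_pi_comp P (submxrow mu i) (iv_up xi i))
    & sd_s P (iv_s xi) <= sd_s P x].
Proof.
case: xi => a lo up b CX [[/= Xa Xlo Xup Xb] xi_min] Cx.
have Xx : sd_X P x /\ - sd_h P th x <= 0.
  by rewrite oppr_le0; split=> //; exact: CX.
split=> /= [|i|i|].
- have := xi_min (InnerVars x lo up b) (And4 Xx Xlo Xup Xb).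
  by rewrite /calF /= !lerD2r.
- pose lo' j := if j == i then x else lo j.
  have Xlo' j : sd_X P (lo' j) /\ - sd_h P th (lo' j) <= 0.
    by rewrite /lo'; case: (j == i).
  have := xi_min (InnerVars a lo' up b) (And4 Xa Xlo' Xup Xb).
  rewrite /calF /= lerD2r lerD2l !sumrB lerD2r.
  exact: (sum_update_le _ _ _ (fun j => sd_pi_comp P (submxrow mu j))).
- pose up' j := if j == i then x else up j.
  have Xup' j : sd_X P (up' j) /\ - sd_h P th (up' j) <= 0.
    by rewrite /up'; case: (j == i).
  have := xi_min (InnerVars a lo up' b) (And4 Xa Xlo Xup' Xb).
  rewrite /calF /= lerD2r lerD2l !sumrB lerD2l -!sumrN.
  rewrite -[_ <= sd_pi_comp _ _ (up i)]lerN2.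
  exact: (sum_update_le _ _ _ (fun j y => - sd_pi_comp P (submxrow mu j) y)).
- have := xi_min (InnerVars a lo up x) (And4 Xa Xlo Xup Xx).
  by rewrite /calF /= lerD2l.
Qed.

(** The tolerance of the approximate minimizer [xi] is absorbed by the margin
    of the outer constraints at [xi]. *)
Lemma eps_optimal_constraints (R : realType) (n m nth : nat)
    (nmu : 'I_m -> nat) (P : synthesis_data R n nth nmu)
    (epsf epsF rho_star : R) (xi : inner_vars R n m) (th : 'rV[R]_nth)
    (mu : 'rV[R]_(\sum_i nmu i)) (x : 'rV[R]_n) :
  sd_C P th `<=` sd_X P -> eps_optimal P epsf epsF rho_star xi th mu ->
  sd_C P th x ->
  [/\ 0 <= calH P th mu x, sd_U P (sd_pi P mu x) & sd_S P x].
Proof.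
move=> CX [_ _ [oH olo oup os] [xis xis_min [aH alo aup a_s]] _] Cx.
have [mH mlo mup ms] :=
  inner_minimizer_separate _ _ _ _ _ _ _ _ _ _ CX xis_min Cx.
split.
- lra.
- move=> i; rewrite mxE.
  have := (olo i, oup i, alo i, aup i, mlo i, mup i).
  by move=> [[[[[? ?] ?] ?] ?] ?]; apply/andP; split; lra.
- rewrite /sd_S /superlevel /=; lra.
Qed.

(** This is where [gamma <= id] enters: the decrease condition leaves
    [h (f (x, pi x)) >= h x - gamma (h x)], which must be nonnegative. *)
Lemma friend_invariant (R : realType) (n m : nat)
    (f : 'rV[R]_n * 'rV[R]_m -> 'rV[R]_n) (U : set 'rV[R]_m)
    (gamma : R -> R) (h : 'rV[R]_n -> R) (pi : 'rV[R]_n -> 'rV[R]_m)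
    (x : 'rV[R]_n) :
  (forall r, 0 <= r -> gamma r <= r) -> is_friend f U gamma h pi ->
  superlevel h x -> superlevel h (f (x, pi x)).
Proof.
move=> gamma_le fr hx; have [_ dec] := fr x hx.
by have := gamma_le _ hx; rewrite /superlevel /=; lra.
Qed.

Lemma invariant_is_safe (R : realType) (n m : nat)
    (f : 'rV[R]_n * 'rV[R]_m -> 'rV[R]_n) (U : set 'rV[R]_m)
    (S C : set 'rV[R]_n) (pi : 'rV[R]_n -> 'rV[R]_m) :
  C !=set0 -> C `<=` S -> (forall x, C x -> U (pi x)) ->
  (forall x, C x -> C (f (x, pi x))) -> is_safe f U S C.
Proof.
move=> [x0 Cx0] CS CU CC; split=> //.
(* The policy must be admissible on all of S: outside C, where nothing is known
   about pi, it takes a constant value of U. *)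
exists (fun x => if x \in C then pi x else pi x0).
  by move=> x _; case: ifPn => [/set_mem/CU //|_]; exact: CU.
move=> x Cx step t; apply: CS.
by elim: t => // t Ct; rewrite step mem_set //; exact: CC.
Qed.

Theorem theorem4 (R : realType) (n m nth : nat) (nmu : 'I_m -> nat)
    (P : synthesis_data R n nth nmu) (epsf epsF rho_star : R)
    (bxi : inner_vars R n m) (bth : 'rV[R]_nth)
    (bmu : 'rV[R]_(\sum_i nmu i)) :
  standing_assumptions P ->
  0 < epsf -> 0 < epsF ->
  BP_minimum P epsf rho_star ->
  eps_optimal P epsf epsF rho_star bxi bth bmu ->
  let h := sd_h P bth in
  let pi := sd_pi P bmu in
  let gamma := sd_gamma P in
  let f := sd_f P in
  let U := sd_U P in
  let S := sd_S P in
  let C := sd_C P bth in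
  [/\ (forall x, C x -> h (f (x, pi x)) - h x >= - gamma (h x)),
      (forall x, C x -> U (pi x)) /\ is_friend f U gamma h pi,
      C `<=` S,
      is_DTCBF f U gamma h /\
      (exists X0, [/\ X0 `<=` C, X0 !=set0 & is_safe f U S X0])
    & C !=set0 /\ sd_rho P bth + epsF >= - rho_star].
Proof.
move=> [[_ _ _ _ [_ gamma_le]] _ _ _ [CX _ _]] _ _ _ opt h pi gamma f U S C.
have [[Thb _] [[_ hb] _ _ _] _ _ rho_le] := opt.
have con x := eps_optimal_constraints _ _ _ _ _ _ _ _ _ _ _ _ x (CX _ Thb) opt.
have dec x : C x -> h (f (x, pi x)) - h x >= - gamma (h x).
  by move=> /con[+ _ _]; rewrite /calH -/h -/pi -/gamma -/f; lra.
have CU x : C x -> U (pi x) by move=> /con[].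
have CS : C `<=` S by move=> x /con[].
have fr : is_friend f U gamma h pi.
  by move=> x Cx; split; [exact: CU|exact: dec].
have C0 : C !=set0 by exists (iv_h bxi); rewrite oppr_le0 in hb.
split=> //; split.
- by move=> x Cx; exists (pi x); [exact: CU|exact: dec].
- exists C; split=> //; apply: (invariant_is_safe _ _ _ _ _ _ _ pi) => // x.
  exact: (friend_invariant _ _ _ _ U gamma).
Qed.
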